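(* Consider the disordered monomer-dimer model on a finite graph $G$ with maximum degree $D$. There exist constants $c,C>0$ depending only on $D$ and the weight distributions (and not otherwise on $G$) such that for any edge $e\in E(G)$ and any $R\ge1$, $$\mathbf{E}\left|\langle\mathbf{1}_{\{e\in\mathsf{M}_G\}}\rangle-\langle\mathbf{1}_{\{e\in\mathsf{M}_{\mathbb{B}^e_R}\}}\rangle\right|\le Ce^{-cR}.$$
   Context: Let $G=(V(G),E(G))$ be a finite graph. A (partial) matching of $G$ is a set of edges of $G$ no two of which share a vertex; $\mathcal{M}_G$ is the set of all matchings of $G$ (including the empty one). For $x\in V(G)$ and $M\in\mathcal{M}_G$, $x\notin M$ means that $x$ is not an endpoint of any edge of $M$ (it is unmatched). The edges carry i.i.d. real weights $(w_e)_{e\in E(G)}$ and the vertices carry i.i.d. real weights $(\nu_x)_{x\in V(G)}$; the edge weights are independent of the vertex weights, and the two distributions may differ. The disordered monomer-dimer model on $G$ (with inverse temperature normalized to $1$, absorbed in the weights) is the random Gibbs measure $\mu_G(M)=Z_G^{-1}\exp(\sum_{e\in M}w_e+\sum_{x\notin M}\nu_x)$, $M\in\mathcal{M}_G$, where $Z_G$ is the normalizing constant. For a subgraph $H\subseteq G$, $\mathsf{M}_H$ denotes a random matching of $H$ sampled from the Gibbs measure $\mu_H$ on $\mathcal{M}_H$ defined by the same formula on $H$, with the weights of the vertices and edges of $H$ kept unchanged from $G$. $\langle\cdot\rangle$ denotes Gibbs expectation (for fixed weights), so $\langle\mathbf{1}_{\{e\in\mathsf{M}_H\}}\rangle=\mu_H(\{M:e\in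 M\})$. $\mathbf{E}$ refers to the randomness of the weights. For an edge $e=(xy)$ of $G$, $\mathbb{B}^e_R$ is the subgraph of $G$ induced by all vertices at graph distance at most $R$ from either $x$ or $y$. *)

(* Defs.v *)
From HB Require Import structures.
From mathcomp Require Import all_boot all_order all_algebra.
From mathcomp Require Import all_classical all_reals all_analysis.

Set Implicit Arguments.
Unset Strict Implicit.
Unset Printing Implicit Defensive.

Import Order.TTheory GRing.Theory Num.Theory.
Import numFieldNormedType.Exports.

Local Open Scope ring_scope.

(* Finite simple graphs whose vertices are taken in an ambient finite type, so
   that a subgraph of a graph is again a graph over the same type and the
   weights (indexed by vertices and edges) are shared between them. *)
Record graph (V : finType) := Graph {
  vertices : {set V};
  edges : {set {set V}};
  edges_sub : forall e : {set V}, e \in edges -> e \subset vertices;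
  edges_card : forall e : {set V}, e \in edges -> #|e| = 2%N
}.

Section Graphs.
Variables (V : finType) (G : graph V).
Implicit Types (x y : V) (e : {set V}) (S : {set V}).

Definition adj x y : bool := [set x; y]%SET \in edges G.

Definition degree x : nat := #|[set e in edges G | x \in e]%SET|.

Definition max_degree : nat := \max_(x in vertices G) degree x.

Fact induced_edges_sub S e :
  e \in [set f in edges G | f \subset S]%SET -> e \subset (vertices G :&: S)%SET.
Proof. by rewrite inE finset.subsetI => /andP[/edges_sub -> ->]. Qed.

Fact induced_edges_card S e :
  e \in [set f in edges G | f \subset S]%SET -> #|e| = 2%N.
Proof. by rewrite inE => /andP[/edges_card]. Qed.

Definition induced_subgraph S : graph V :=
  Graph (@induced_edges_sub S) (@induced_edges_card S).

(* The infimum is +oo when x and y are not connected. *)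
Definition gdist (R : realType) x y : \bar R :=
  ereal_inf [set (size p)%:R%:E | p in
    [set p : seq V | path adj x p /\ last x p = y]]%classic.

Definition edge_ball (R : realType) e (r : R) : graph V :=
  induced_subgraph [set v in vertices G | [exists x in e, (gdist R x v <= r%:E)%E]]%SET.

Definition matching (M : {set {set V}}) : bool :=
  (M \subset edges G) && finset.trivIset M.

Definition gibbs_weight (R : realType) (w : {set V} -> R) (nu : V -> R)
    (M : {set {set V}}) : R :=
  expR (\sum_(e in M) w e + \sum_(x in vertices G | x \notin finset.cover M) nu x).

Definition partition_function (R : realType) (w : {set V} -> R) (nu : V -> R) : R :=
  \sum_(M : {set {set V}} | matching M) gibbs_weight w nu M.

Definition gibbs (R : realType) (w : {set V} -> R) (nu : V -> R)
    (M : {set {set V}}) : R :=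
  gibbs_weight w nu M / partition_function w nu.

Definition gibbs_expectation (R : realType) (w : {set V} -> R) (nu : V -> R)
    (f : {set {set V}} -> R) : R :=
  \sum_(M : {set {set V}} | matching M) f M * gibbs w nu M.

End Graphs.

(* Mutual independence of the subfamily (X i) with i in A; the values of X
   outside A are unconstrained. *)
Definition mutually_independent d (T : measurableType d) (R : realType)
    (P : probability T R) (I : finType) (A : {set I}) (X : I -> {RV P >-> R}) :=
  forall (J : {set I}) (B : I -> set R), J \subset A ->
    (forall i, i \in J -> measurable (B i)) ->
    (P (\bigcap_(i in [set` J]) (X i @^-1` B i))%classic =
     \prod_(i in J) P (X i @^-1` B i)%classic)%E.

Definition weight_family d (T : measurableType d) (R : realType)
    (P : probability T R) (V : finType) (w : {set V} -> {RV P >-> R})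
    (nu : V -> {RV P >-> R}) (i : {set V} + V) : {RV P >-> R} :=
  match i with inl e => w e | inr x => nu x end.

(* The edge weights (w e) are i.i.d. of law mu_e, the vertex weights (nu x) are
   i.i.d. of law mu_v, and the two families are independent of each other, i.e.
   all the weights taken together are mutually independent.  Only the values of
   w on edges of G and of nu on vertices of G matter. *)
Definition disordered_weights d (T : measurableType d) (R : realType)
    (P : probability T R) (V : finType) (G : graph V)
    (mu_e mu_v : probability R R)
    (w : {set V} -> {RV P >-> R}) (nu : V -> {RV P >-> R}) : Prop :=
  [/\ forall e (B : set R), e \in edges G -> measurable B ->
        distribution P (w e) B = mu_e B,
      forall x (B : set R), x \in vertices G -> measurable B ->
        distribution P (nu x) B = mu_v B
    & mutually_independent
        ([set inl e | e in edges G] :|: [set inr x | x in vertices G])%SET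
        (weight_family w nu)].

(* Main.v *)
Require Import Defs.
From HB Require Import structures.
From mathcomp Require Import all_boot all_order all_algebra.
From mathcomp Require Import all_classical all_reals all_analysis.
From mathcomp Require Import measurable_realfun ring lra zify.

(** The proof is a disagreement percolation argument.  Sample a matching of [G]
    and, independently, one of the ball.  Their symmetric difference is made of
    alternating paths and cycles, and as long as the component of [e] does not
    reach the boundary of the ball, exchanging the two matchings along it shows
    that both give the same probability to [e].  An alternating path arriving
    at [x] stops there with the probability that [x] is unmatched in the other
    matching, given what has been explored.  That probability is at least
    [1 / (1 + K)] as soon as the local quantity
    [a x = sum_(y ~ x) exp (w_xy - nu_x - nu_y)] is at most [K]; such an [x] is
    called tame.  Hence the path survives [m] tame vertices with probability at
    most [(K / (1 + K)) ^ m].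

    No coupling is constructed.  The unmatched probability [u S x], for the
    model on the vertex set [S], satisfies
    [1 / u S x = 1 + sum_(y ~ x) b x y * u (S \ x) y] with
    [b x y = exp (w_xy - nu_x - nu_y)] ([free_prob_rec]).  Subtracting two such
    identities bounds the relative error [`|u S' x / u S x - 1|] by an average,
    over the partner [y] of [x] under the Gibbs measure on [S'], of the same
    quantity with [S' \ x] and [S \ x] exchanged ([discrepancy_step]).  This
    exchange is the alternation of the path; the total mass [1 - u S' x] of the
    average is the survival probability.  Iterating gives [discrepancy_decay]
    and [edge_prob_decay].

    It remains to see that tame vertices are abundant on every long path.  A
    vertex fails to be tame only if one of the boundedly many weights near it
    is heavy, that is, edge weight above [L] or vertex weight below [- L].  A
    simple path of length [n] with too few tame vertices therefore sees at
    least a fixed fraction of [n] distinct heavy weights among the [O(n)]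
    weights near it ([untame_path_heavy]).  There are at most [D ^ n] paths and
    [2 ^ O(n)] sets of weights, while by independence [s] prescribed weights are
    all heavy with probability at most [eps ^ s], where [eps] tends to [0] as
    [L] grows.  For [L] large the union bound is exponentially small
    ([exceptional_prob], [exceptional_bound]); outside this exceptional event
    the deterministic decay applies. *)

Set Implicit Arguments.
Unset Strict Implicit.
Unset Printing Implicit Defensive.

Import Order.TTheory GRing.Theory Num.Theory.
Import numFieldNormedType.Exports.

Local Open Scope ring_scope.

(** * Graphs *)

Lemma graph_eq (V : finType) (G H : graph V) :
  vertices G = vertices H -> edges G = edges H -> G = H.
Proof.
case: G H => [vG eG subG cardG] [vH eH subH cardH] /= eqv eqe.
subst vH eH; congr Graph; exact: Prop_irrelevance.
Qed.

Section GraphFacts.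
Variables (V : finType) (G : graph V).

(** Presents [G] and its balls as induced subgraphs of the same graph, so that
    both Gibbs measures are indexed by a vertex set. *)
Lemma induced_subgraphT : induced_subgraph G finset.setT = G.
Proof.
apply: graph_eq => /=; first by rewrite finset.setIT.
by apply/setP => f; rewrite inE finset.subsetT andbT.
Qed.

Lemma adjC x y : adj G x y = adj G y x.
Proof. by rewrite /adj finset.setUC. Qed.

Lemma adj_neq x y : adj G x y -> x != y.
Proof. by move=> /edges_card; rewrite cards2; case: eqP. Qed.

Lemma adj_vertices x y : adj G x y -> (x \in vertices G) && (y \in vertices G).
Proof. by move=> /edges_sub; rewrite finset.subUset !finset.sub1set. Qed.

Lemma edge_adj f x : f \in edges G -> x \in f ->
  exists2 y, adj G x y & f = [set x; y]%SET.
Proof.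
move=> fG xf; have /eqP /cards2P [a [b [neq_ab eqf]]] := edges_card fG.
move: xf; rewrite eqf !inE => /orP[] /eqP ->.
  by exists b => //; rewrite /adj -eqf.
by exists a; rewrite ?/adj 1?finset.setUC -?eqf // eqf finset.setUC.
Qed.

End GraphFacts.

Lemma pair_set_inj (V : finType) (x : V) : injective (fun y => [set x; y]%SET).
Proof.
move=> y z /setP eqyz; have := eqyz y; have := eqyz z; rewrite !inE !eqxx !orbT.
by case: (z =P x) => [->|_] /=; [rewrite orbb => _ /esym/eqP | move/eqP].
Qed.

(** * Deletion recursions for partition functions *)

Section MatchingSums.
Variables (R : realType) (V : finType) (G : graph V).
Variables (w : {set V} -> R) (nu : V -> R).
Implicit Types (S : {set V}) (M : {set {set V}}).

Local Notation H S := (induced_subgraph G S).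
Local Notation Z S := (partition_function (H S) w nu).

Lemma matchingP S M : reflect
  [/\ M \subset edges G, forall f, f \in M -> f \subset S & finset.trivIset M]
  (matching (H S) M).
Proof.
apply: (iffP andP) => [[/fintype.subsetP subM tM]|[/fintype.subsetP subM subS tM]].
  split=> //; first by apply/fintype.subsetP => f /subM; rewrite inE => /andP[].
  by move=> f /subM; rewrite inE => /andP[].
by split=> //; apply/fintype.subsetP => f fM; rewrite inE subM ?subS.
Qed.

Lemma mem_cover x M : (x \in finset.cover M) = [exists f in M, x \in f].
Proof.
by apply/bigcupP/exists_inP => -[f]; exists f.
Qed.

(** The matchings of [S] leaving [x] free are the matchings of [S \ x]; the
    monomer at [x] contributes the factor [exp (nu x)]. *)
Lemma sum_matchings_avoiding S x : x \in vertices G -> x \in S ->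
  \sum_(M | matching (H S) M && (x \notin finset.cover M)) gibbs_weight (H S) w nu M
    = expR (nu x) * Z (S :\ x)%SET.
Proof.
move=> xG xS; rewrite /partition_function big_distrr /=.
apply: eq_big => [M|M /andP[_ xM]].
  apply/andP/idP => [[/matchingP[subM subS tM] xM]|/matchingP[subM subS tM]].
    apply/matchingP; split=> // f fM; apply/fintype.subsetP => z zf.
    rewrite !inE (fintype.subsetP (subS _ fM)) // andbT.
    by apply: contraNneq xM => <-; rewrite mem_cover; apply/exists_inP; exists f.
  split; last first.
    rewrite mem_cover; apply/exists_inP => -[f /subS /fintype.subsetP fS /fS].
    by rewrite !inE eqxx.
  apply/matchingP; split=> // f /subS fS.
  by apply: (fintype.subset_trans fS); exact: finset.subD1set.
rewrite /gibbs_weight -expRD; congr expR.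
rewrite addrCA; congr (_ + _).
rewrite (bigD1 x) /=; last by rewrite !inE xG xS.
by congr (_ + _); apply: eq_bigl => z; rewrite !inE; case: (z == x); rewrite ?andbF ?andbT.
Qed.

(** Adding the edge [xy] is a bijection from the matchings of [S \ {x, y}] onto
    the matchings of [S] that contain [xy]. *)
Lemma sum_matchings_containing S x y : adj G x y -> x \in S -> y \in S ->
  \sum_(M | matching (H S) M && ([set x; y]%SET \in M)) gibbs_weight (H S) w nu M
    = expR (w [set x; y]%SET) * Z (S :\ x :\ y)%SET.
Proof.
move=> xy xS yS; set f := [set x; y]%SET.
rewrite /partition_function big_distrr /=.
have fx : x \in f by rewrite !inE eqxx.
(* Reindexing by [N = M \ f]. *)
rewrite (reindex_onto (fun N => f |: N)%SET (fun M => M :\ f)%SET) /=; last first.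
  by move=> M /andP[_ fM]; exact: finset.setD1K.
have E N : [&& matching (H S) (f |: N)%SET, f \in (f |: N)%SET
               & ((f |: N) :\ f)%SET == N] = matching (H (S :\ x :\ y)%SET) N.
  apply/and3P/matchingP => [[/matchingP[subM subS /finset.trivIsetP tM] _ /eqP eqN]|].
    have fN : f \notin N by rewrite -eqN !inE eqxx.
    have NfN g : g \in N -> g \in (f |: N)%SET by move=> gN; rewrite inE gN orbT.
    split.
    - by apply/fintype.subsetP => g /NfN /(fintype.subsetP subM).
    - move=> g gN; apply/fintype.subsetP => z zg.
      rewrite !inE (fintype.subsetP (subS _ (NfN _ gN))) // andbT.
      have neq_fg : f != g by apply: contraNneq fN => ->.
      have := tM _ _ (finset.setU11 f N) (NfN _ gN) neq_fg.
      rewrite disjoint_sym => /disjointFr /(_ zg); rewrite !inE.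
      by move/norP => [-> ->].
    - by apply/finset.trivIsetP => g h /NfN gM /NfN hM; exact: tM.
  move=> [subM subS /finset.trivIsetP tM].
  have Nf g : g \in N -> [disjoint f & g].
    move=> /subS /fintype.subsetP gS; rewrite disjoint_sym.
    apply/pred0P => z /=; apply/negP => /andP[/gS].
    by rewrite !inE; case: (z == x); case: (z == y).
  have fN : f \notin N.
    by apply/negP => /Nf /pred0P /(_ x) /=; rewrite fx.
  split; [|by rewrite finset.setU11|by rewrite finset.setU1K].
  apply/matchingP; split.
  - by rewrite finset.subUset finset.sub1set subM andbT.
  - move=> g; rewrite !inE => /orP[/eqP ->|/subS gS].
      by rewrite finset.subUset !finset.sub1set xS.
    by apply: (fintype.subset_trans gS); rewrite !finset.subDset !finset.subsetU ?fintype.subxx ?orbT.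
  - apply/finset.trivIsetP => g h; rewrite !inE => /orP[/eqP ->|gN] /orP[/eqP ->|hN].
    + by rewrite eqxx.
    + by rewrite Nf.
    + by rewrite disjoint_sym Nf.
    + exact: tM.
apply: eq_big => [N|N]; first by rewrite -andbA E.
rewrite -andbA => /and3P[_ _ /eqP eqN].
have fN : f \notin N by rewrite -eqN !inE eqxx.
rewrite /gibbs_weight -expRD; congr expR.
rewrite big_setU1 //= -addrA; congr (_ + (_ + _)).
apply: eq_bigl => z; rewrite !inE.
have -> : (z \in finset.cover (f |: N)%SET) = (z \in f) || (z \in finset.cover N).
  by rewrite /finset.cover finset.bigcup_setU big_set1 inE.
by rewrite !inE !negb_or; case: (z == x); case: (z == y); rewrite ?andbF ?andbT.
Qed.

(** In a matching, a vertex is free or has exactly one partner.  Written with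
    indicators, so that summing against the Gibbs weights decomposes the
    partition function. *)
Lemma matching_cover_indicator S M x : matching (H S) M ->
  (x \notin finset.cover M)%:R + \sum_(y | adj G x y && (y \in S)) ([set x; y]%SET \in M)%:R
    = 1 :> R.
Proof.
move=> /matchingP[subM subS /finset.trivIsetP tM].
have [|/= xM] := boolP (x \in finset.cover M).
  rewrite mem_cover => /exists_inP[f fM xf]; rewrite add0r.
  have [y xy eqf] := edge_adj (fintype.subsetP subM _ fM) xf.
  have yS : y \in S.
    by apply: (fintype.subsetP (subS _ fM)); rewrite eqf !inE eqxx orbT.
  rewrite (bigD1 y) ?xy //= -eqf fM big1 ?addr0 // => z /andP[_ neq_zy].
  apply/eqP; rewrite pnatr_eq0 eqb0; apply/negP => gM.
  suff : [set x; z]%SET = f by rewrite eqf => /pair_set_inj /eqP; rewrite (negPf neq_zy).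
  apply/eqP/negP => /negP /(tM _ _ gM fM) /pred0P /(_ x) /=.
  by rewrite xf !inE eqxx.
rewrite big1 ?addr0 // => y _; apply/eqP; rewrite pnatr_eq0 eqb0.
by apply: contra xM => fM; rewrite mem_cover; apply/exists_inP; exists [set x; y]%SET;
  rewrite ?inE ?eqxx.
Qed.

Lemma partition_function_gt0 (K : graph V) : 0 < partition_function K w nu.
Proof.
rewrite /partition_function (bigD1 finset.set0) /=; last first.
  by rewrite /matching finset.sub0set; apply/finset.trivIsetP => A B; rewrite inE.
rewrite ltr_pwDl ?expR_gt0 // sumr_ge0 // => M _; exact: expR_ge0.
Qed.

Lemma partition_function_rec S x : x \in vertices G -> x \in S ->
  Z S = expR (nu x) * Z (S :\ x)%SET +
    \sum_(y | adj G x y && (y \in S)) expR (w [set x; y]%SET) * Z (S :\ x :\ y)%SET.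
Proof.
move=> xG xS; rewrite -sum_matchings_avoiding // [LHS]/partition_function.
under [X in _ + X]eq_bigr => y /andP[xy yS] do rewrite -sum_matchings_containing //.
rewrite [X in _ = X + _]big_mkcondr /=.
under [X in _ + X]eq_bigr => y _ do rewrite big_mkcondr /=.
rewrite exchange_big /= -big_split /=; apply: eq_bigr => M mM.
rewrite -[LHS]mul1r -(matching_cover_indicator x mM) mulrDl mulr_suml; congr (_ + _).
  by case: ifP; rewrite ?mul1r ?mul0r.
by apply: eq_bigr => y _; case: ifP; rewrite ?mul1r ?mul0r.
Qed.

(** The Gibbs probability that [x] is unmatched, for the model on [S]. *)
Definition free_prob S x : R := expR (nu x) * Z (S :\ x)%SET / Z S.

(** Weight of the dimer [xy] relative to the two monomers that it replaces. *)
Definition edge_factor x y : R := expR (w [set x; y]%SET - nu x - nu y).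

Lemma free_prob_gt0 S x : 0 < free_prob S x.
Proof. by rewrite divr_gt0 ?mulr_gt0 ?expR_gt0 ?partition_function_gt0. Qed.

(** This is the recursion along the tree of self-avoiding walks: the children
    of [x] are its neighbours, in the graph from which [x] has been deleted. *)
Lemma free_prob_rec S x : x \in vertices G -> x \in S ->
  (free_prob S x)^-1 =
    1 + \sum_(y | adj G x y && (y \in S)) edge_factor x y * free_prob (S :\ x)%SET y.
Proof.
move=> xG xS; have Zx := lt0r_neq0 (partition_function_gt0 (H (S :\ x)%SET)).
rewrite /free_prob invf_div (partition_function_rec xG xS) mulrDl divff; last first.
  by rewrite mulf_neq0 // lt0r_neq0 ?expR_gt0.
congr (_ + _); rewrite mulr_suml; apply: eq_bigr => y _.
rewrite /edge_factor !expRD !expRN.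
have := lt0r_neq0 (expR_gt0 (nu x)); have := lt0r_neq0 (expR_gt0 (nu y)) => ny nx.
by field; rewrite nx ny Zx.
Qed.

Lemma edge_prob S x y : adj G x y -> x \in S -> y \in S ->
  gibbs_expectation (H S) w nu (fun M => ([set x; y]%SET \in M)%:R)
    = free_prob S x * edge_factor x y * free_prob (S :\ x)%SET y.
Proof.
move=> xy xS yS; rewrite /gibbs_expectation.
transitivity (expR (w [set x; y]%SET) * Z (S :\ x :\ y)%SET / Z S).
  rewrite -sum_matchings_containing // mulr_suml [RHS]big_mkcondr /=.
  by apply: eq_bigr => M _; rewrite /gibbs; case: ifP; rewrite ?mul1r ?mul0r.
have Zx := lt0r_neq0 (partition_function_gt0 (H (S :\ x)%SET)).
have ZS := lt0r_neq0 (partition_function_gt0 (H S)).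
rewrite /free_prob /edge_factor !expRD !expRN.
have := lt0r_neq0 (expR_gt0 (nu x)); have := lt0r_neq0 (expR_gt0 (nu y)) => ny nx.
move: (expR (nu x)) (expR (nu y)) nx ny (expR (w _)) => a b a0 b0 c.
move: (Z S) (Z (S :\ x)%SET) (Z _) ZS Zx => z zx zxy z0 zx0.
by field; rewrite ?nx ?ny ?z0 ?zx0 ?a0 ?b0.
Qed.

End MatchingSums.

(** * Contraction along alternating paths *)

Section Contraction.
Variables (R : realType) (V : finType) (G : graph V).
Variables (w : {set V} -> R) (nu : V -> R).
Implicit Types (S : {set V}) (x y : V).

Local Notation u := (free_prob G w nu).
Local Notation b := (edge_factor w nu).

Lemma edge_factor_gt0 x y : 0 < b x y.
Proof. exact: expR_gt0. Qed.

Let edge_prob_ge0 S T x y : 0 <= u S x * b x y * u T y.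
Proof.
apply/ltW/mulr_gt0; last exact: free_prob_gt0.
by apply: mulr_gt0; [exact: free_prob_gt0 | exact: edge_factor_gt0].
Qed.

Lemma free_prob_le1 S x : x \in vertices G -> x \in S -> u S x <= 1.
Proof.
move=> xG xS; rewrite -(invrK (u S x)) invf_le1 ?invr_gt0 ?free_prob_gt0 //.
rewrite free_prob_rec // lerDl sumr_ge0 // => y _.
by rewrite ltW // mulr_gt0 ?edge_factor_gt0 ?free_prob_gt0.
Qed.

Lemma sum_edge_prob S x : x \in vertices G -> x \in S ->
  \sum_(y | adj G x y && (y \in S)) u S x * b x y * u (S :\ x)%SET y = 1 - u S x.
Proof.
move=> xG xS; under eq_bigr do rewrite -mulrA.
have /eqP := free_prob_rec w nu xG xS; rewrite addrC -subr_eq => /eqP eqs.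
rewrite -mulr_sumr -eqs mulrBr mulr1 divff //.
exact: lt0r_neq0 (free_prob_gt0 _ _ _ _ _).
Qed.

(** Relative rather than absolute error: it is the relative error that is
    averaged by a subprobability when a vertex is deleted. *)
Definition discrepancy S S' x : R := `|u S' x / u S x - 1|.

Lemma discrepancyE S S' x : discrepancy S S' x = `|u S' x - u S x| / u S x.
Proof.
have u0 := free_prob_gt0 G w nu S x.
rewrite /discrepancy -[X in _ - X](divff (lt0r_neq0 u0)) -mulrBl normrM.
by rewrite (gtr0_norm (x := (u S x)^-1)) // invr_gt0.
Qed.

(** One step of the alternating path.  Since [1 / u] is affine in the values of
    [u] at the neighbours, the discrepancy at [x] is at most
    [sum_y u S' x * b x y * `|u (S \ x) y - u (S' \ x) y|].  Dividing and
    multiplying by [u (S' \ x) y] turns the coefficients into the probabilities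
    that [x] is matched to [y] in [S'], and makes [S' \ x] the reference set:
    the two sets exchange their roles at each step. *)
Lemma discrepancy_step S S' x : x \in vertices G -> x \in S -> x \in S' ->
  (forall y, adj G x y -> (y \in S) = (y \in S')) ->
  discrepancy S S' x <= \sum_(y | adj G x y && (y \in S'))
    u S' x * b x y * u (S' :\ x)%SET y * discrepancy (S' :\ x)%SET (S :\ x)%SET y.
Proof.
move=> xG xS xS' SS'; have u'0 := free_prob_gt0 G w nu S' x.
have -> : discrepancy S S' x = u S' x *
    `|\sum_(y | adj G x y && (y \in S')) b x y * (u (S :\ x)%SET y - u (S' :\ x)%SET y)|.
  under eq_bigr do rewrite mulrBr.
  rewrite sumrB -[u S' x in RHS]gtr0_norm // -normrM; congr `|_|.
  rewrite (free_prob_rec w nu xG xS).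
  have /eqP := free_prob_rec w nu xG xS'; rewrite addrC -subr_eq => /eqP <-.
  rewrite (eq_bigl (fun y => adj G x y && (y \in S'))); last first.
    by move=> y /=; case: (boolP (adj G x y)) => //= /SS' ->.
  by move: (\sum_(_ | _) _) => t; field; exact: lt0r_neq0.
apply: (@le_trans _ _ (u S' x * \sum_(y | adj G x y && (y \in S'))
    b x y * `|u (S :\ x)%SET y - u (S' :\ x)%SET y|)).
  rewrite ler_pM2l //; apply: le_trans (ler_norm_sum _ _ _) _.
  by apply: ler_sum => y _; rewrite normrM gtr0_norm ?edge_factor_gt0.
rewrite mulr_sumr; apply: ler_sum => y _; rewrite discrepancyE.
have := free_prob_gt0 G w nu (S' :\ x)%SET y.
move: (u S' x) (u (S' :\ x)%SET y) => a c c0.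
by rewrite le_eqVlt -!mulrA [c * _]mulrC mulfVK ?eqxx // lt0r_neq0.
Qed.

(** Tameness only involves weights near [x], and it controls the unmatched
    probability of [x] uniformly over the vertex set. *)
Definition tame (K : R) x : bool := \sum_(y | adj G x y) b x y <= K.

Lemma free_prob_tame K S x : x \in vertices G -> x \in S -> tame K x ->
  (u S x)^-1 <= 1 + K.
Proof.
move=> xG xS; rewrite free_prob_rec // lerD2l /tame; apply: le_trans.
rewrite big_mkcondr /=; apply: ler_sum => y xy.
case: ifP => yS; last exact: ltW (edge_factor_gt0 _ _).
rewrite ler_piMr ?(ltW (edge_factor_gt0 _ _)) // free_prob_le1 //.
  by case/andP: (adj_vertices xy).
by rewrite !inE yS eq_sym (adj_neq xy).
Qed.

(** Starting bound for the induction: at a tame vertex the relative error is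
    bounded, whereas at an arbitrary vertex it may be of the order of
    the sum of the [b x y]. *)
Lemma discrepancy_tame K S S' x : x \in vertices G -> x \in S -> x \in S' ->
  tame K x -> discrepancy S S' x <= 1 + K.
Proof.
move=> xG xS xS' /(free_prob_tame xG xS) uK.
have u0 : 0 < (u S x)^-1 by rewrite invr_gt0 free_prob_gt0.
have u'0 := free_prob_gt0 G w nu S' x; have u'1 := free_prob_le1 xG xS'.
have le_r : u S' x / u S x <= 1 + K by apply: le_trans uK; rewrite ler_piMl // ltW.
have r_ge0 : 0 <= u S' x / u S x by rewrite mulr_ge0 // ltW.
have : 1 <= (u S x)^-1.
  by rewrite -[X in X <= _]invr1 lef_pV2 ?posrE ?free_prob_gt0 ?free_prob_le1.
move: uK u0 r_ge0 le_r; rewrite /discrepancy.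
move: (u S' x / u S x) ((u S x)^-1) => r v; rewrite ler_norml => *; apply/andP; split; lra.
Qed.

(** Each tame vertex met by the path costs a factor [K / (1 + K)], the others
    cost nothing since the averages have mass at most [1].  The iteration stops
    at the last tame vertex that is counted, where the discrepancy is bounded;
    this is why paths must contain [m.+1] tame vertices for [m] factors. *)
Lemma discrepancy_decay K (n m : nat) S S' x : 0 <= K ->
    x \in vertices G -> x \in S -> x \in S' ->
    (forall p, path (adj G) x p -> (size p <= n)%N ->
       (last x p \in S) = (last x p \in S')) ->
    (forall p, path (adj G) x p -> uniq (x :: p) -> size p = n ->
       {subset p <= S :&: S'}%SET -> (m < count (tame K) (x :: p))%N) ->
  discrepancy S S' x <= (1 + K) * (K / (1 + K)) ^+ m.
Proof.
move=> K0; have q0 : 0 <= K / (1 + K) by rewrite divr_ge0 ?addr_ge0.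
have K1 : 0 < 1 + K by rewrite ltr_pwDl.
elim: n m S S' x => [|n IHn] m S S' x xG xS xS' agree tame_paths.
  have /= : (m < count (tame K) [:: x])%N by exact: tame_paths.
  rewrite addn0; case: (boolP (tame K x)) => // tx.
  by case: m {tame_paths} => // _; rewrite mulr1 discrepancy_tame.
have [/andP[tx /eqP m0]|ntx] := boolP (tame K x && (m == 0%N)).
  by rewrite m0 mulr1 discrepancy_tame.
have agree1 y : adj G x y -> (y \in S) = (y \in S').
  by move=> xy; apply: (agree [:: y]); rewrite /= ?xy.
apply: le_trans (discrepancy_step xG xS xS' agree1) _.
(* The number of factors still to be gained after leaving [x]. *)
set m' := (m - tame K x)%N.
apply: (@le_trans _ _ (\sum_(y | adj G x y && (y \in S'))
   u S' x * b x y * u (S' :\ x)%SET y * ((1 + K) * (K / (1 + K)) ^+ m'))).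
  apply: ler_sum => y /andP[xy yS']; apply: ler_wpM2l.
    exact: edge_prob_ge0.
  have yS : y \in S by rewrite agree1.
  have neq_yx : y != x by rewrite eq_sym (adj_neq xy).
  apply: IHn; rewrite ?inE ?neq_yx //.
  - by case/andP: (adj_vertices xy).
  - move=> p yp sp; have := agree (y :: p); rewrite /= xy yp.
    by rewrite !inE => /(_ isT sp) ->.
  - move=> p yp up sp subp.
    have xp : x \notin p by apply/negP => /subp; rewrite !inE eqxx.
    have h : (m < tame K x + count (tame K) (y :: p))%N.
      apply: (tame_paths (y :: p)) => [|||z]; first by rewrite /= xy.
      - by rewrite cons_uniq inE negb_or eq_sym neq_yx xp.
      - by rewrite /= sp.
      - rewrite inE => /orP[/eqP ->|/subp]; first by rewrite inE yS.
        by rewrite !inE => /andP[/andP[_ ->] /andP[_ ->]].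
    move: ntx; rewrite /m'; move: h; rewrite negb_and -lt0n.
    by case: (tame K x) => /=; rewrite ?subn0 //; case: (m) => // k; rewrite subn1.
rewrite -mulr_suml sum_edge_prob //.
have u1 := free_prob_le1 xG xS'; have u'0 := free_prob_gt0 G w nu S' x.
have [tx|tx] := boolP (tame K x); last first.
  rewrite /m' (negPf tx) subn0 ler_piMl ?gerBl ?(ltW u'0) //.
  by rewrite mulr_ge0 ?exprn_ge0 ?(ltW K1).
move: ntx; rewrite /m' tx /=; case: (m) => // k _; rewrite subn1 /= exprS.
rewrite [leRHS]mulrCA ler_wpM2r ?mulr_ge0 ?exprn_ge0 ?(ltW K1) //.
have le_u : (1 + K)^-1 <= u S' x.
  by rewrite -[leRHS]invrK lef_pV2 ?posrE ?invr_gt0 ?free_prob_gt0 ?free_prob_tame.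
have -> : K / (1 + K) = 1 - (1 + K)^-1 by field; exact: lt0r_neq0.
by rewrite lerD2l lerN2.
Qed.

Lemma edge_prob_diff S S' x y : adj G x y -> x \in S -> y \in S ->
  x \in S' -> y \in S' ->
  `|gibbs_expectation (induced_subgraph G S) w nu (fun M => ([set x; y]%SET \in M)%:R)
    - gibbs_expectation (induced_subgraph G S') w nu (fun M => ([set x; y]%SET \in M)%:R)|
  <= discrepancy (S :\ x)%SET (S' :\ x)%SET y + discrepancy S' S x.
Proof.
move=> xy xS yS xS' yS'; rewrite !edge_prob //.
have /andP[xG yG] := adj_vertices xy.
have le1 (T : {set V}) : x \in T -> y \in T -> u T x * b x y * u (T :\ x)%SET y <= 1.
  move=> xT yT; rewrite -[leRHS](subrK (u T x)) -sum_edge_prob //.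
  rewrite (bigD1 y) /= ?xy // -addrA lerDl addr_ge0 ?(ltW (free_prob_gt0 _ _ _ _ _)) //.
  by apply: sumr_ge0 => z _; exact: edge_prob_ge0.
have := le1 S xS yS; have := le1 S' xS' yS'; rewrite !discrepancyE.
have := free_prob_gt0 G w nu S x; have := free_prob_gt0 G w nu S' x.
have := free_prob_gt0 G w nu (S :\ x)%SET y; have := free_prob_gt0 G w nu (S' :\ x)%SET y.
have := edge_factor_gt0 x y.
move: (u S x) (u S' x) (u (S :\ x)%SET y) (u (S' :\ x)%SET y) (b x y).
move=> a a' c c' t t0 c'0 c0 a'0 a0 le' le.
(* The two vertices are changed one after the other; each term is an edge
   probability, at most 1, times a relative error. *)
have -> : a * t * c - a' * t * c' =
   a * t * c * ((c - c') / c) + a' * t * c' * ((a - a') / a').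
  by field; rewrite !lt0r_neq0.
apply: le_trans (ler_normD _ _) _; rewrite !normrM !normfV.
rewrite !(gtr0_norm t0) !(gtr0_norm a0) !(gtr0_norm c0) !(gtr0_norm a'0) !(gtr0_norm c'0).
rewrite [`|c' - c|]distrC; apply: lerD.
  by rewrite ler_piMl // divr_ge0 // ltW.
by rewrite ler_piMl // divr_ge0 // ltW.
Qed.

(** The probability of [xy] is [u S x * b x y * u (S \ x) y], so that two
    alternating paths appear, one from each endpoint. *)
Lemma edge_prob_decay K (n m : nat) S S' x y : 0 <= K -> adj G x y ->
    x \in S -> y \in S -> x \in S' -> y \in S' ->
    (forall z p, z \in [set x; y]%SET -> path (adj G) z p -> (size p <= n)%N ->
       (last z p \in S) = (last z p \in S')) ->
    (forall z p, z \in [set x; y]%SET -> path (adj G) z p -> uniq (z :: p) ->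
       size p = n -> (m < count (tame K) (z :: p))%N) ->
  `|gibbs_expectation (induced_subgraph G S) w nu (fun M => ([set x; y]%SET \in M)%:R)
    - gibbs_expectation (induced_subgraph G S') w nu (fun M => ([set x; y]%SET \in M)%:R)|
  <= 2 * (1 + K) * (K / (1 + K)) ^+ m.
Proof.
move=> K0 xy xS yS xS' yS' agree tame_paths; have /andP[xG yG] := adj_vertices xy.
have neq_yx : y != x by rewrite eq_sym (adj_neq xy).
have xe : x \in [set x; y]%SET by rewrite !inE eqxx.
have ye : y \in [set x; y]%SET by rewrite !inE eqxx orbT.
apply: le_trans (edge_prob_diff xy xS yS xS' yS') _.
rewrite -mulrA mulr_natl mulr2n; apply: lerD.
  apply: (discrepancy_decay (n := n)); rewrite ?inE ?neq_yx //.
  - by move=> p yp sp; rewrite !inE agree.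
  - by move=> p yp up sp _; apply: tame_paths.
apply: (discrepancy_decay (n := n)) => //.
- by move=> p xp sp; rewrite agree.
- by move=> p xp up sp _; apply: tame_paths.
Qed.

End Contraction.

(** * Paths and the weights near them *)

Lemma card_bigcup_leq (I T : finType) (A : {set I}) (F : I -> {set T}) :
  (#|\bigcup_(i in A) F i| <= \sum_(i in A) #|F i|)%N.
Proof.
apply: (big_rec2 (fun (X : {set T}) k => #|X| <= k)%N) => [|i k X _ le_Xk].
  by rewrite cards0.
by apply: (leq_trans (leq_card_setU _ _)); rewrite leq_add2l.
Qed.

Section Geometry.
Variables (V : finType) (G : graph V).
Implicit Types (x y z : V) (f : {set V}) (i : {set V} + V).

Definition neighbours x : {set V} := [set y | adj G x y]%SET.

Lemma degree_le_max x : (degree G x <= max_degree G)%N.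
Proof.
have [xG|xG] := boolP (x \in vertices G); first exact: leq_bigmax_cond.
rewrite /degree (_ : finset _ = finset.set0) ?cards0 //.
apply/setP => f; rewrite !inE; apply/negP => /andP[/edges_sub /fintype.subsetP fG /fG].
by rewrite (negPf xG).
Qed.

Lemma card_neighbours x : (#|neighbours x| <= max_degree G)%N.
Proof.
apply: leq_trans (degree_le_max x).
rewrite -(card_imset _ (@pair_set_inj _ x)); apply: subset_leq_card.
apply/fintype.subsetP => _ /imsetP[y + ->]; rewrite !inE eqxx andbT; exact: id.
Qed.

(** An explicit finite list: the union bound ranges over walks. *)
Fixpoint walks n x : seq (seq V) :=
  if n is n'.+1 then
    flatten [seq [seq y :: p | p <- walks n' y] | y <- enum (neighbours x)]
  else [:: [::]].

Lemma mem_walks x p : path (adj G) x p -> p \in walks (size p) x.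
Proof.
elim: p x => [|y p IHp] x //= /andP[xy /IHp yp].
apply/flattenP; exists [seq y :: q | q <- walks (size p) y].
  by apply/mapP; exists y; rewrite ?mem_enum ?inE.
exact: map_f.
Qed.

Lemma size_walks n x : (size (walks n x) <= max_degree G ^ n)%N.
Proof.
elim: n x => [|n IHn] x //=; rewrite size_flatten /shape -map_comp.
apply: (@leq_trans (size (enum (neighbours x)) * max_degree G ^ n)%N); last first.
  by rewrite expnS leq_mul2r -cardE card_neighbours orbT.
elim: (enum _) => [|y s IHs] //=; rewrite mulSn leq_add // size_map.
exact: IHn.
Qed.

Definition weight_sites : {set {set V} + V} :=
  ([set inl e | e in edges G] :|: [set inr x | x in vertices G])%SET.

(** The vertices whose tameness may depend on the weight of site [i]: an edge
    weight is seen by both endpoints, a vertex weight also by the neighbours. *)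
Definition reach i : {set V} :=
  match i with inl f => f | inr y => (y |: neighbours y)%SET end.

Definition near x : {set {set V} + V} := [set i in weight_sites | x \in reach i]%SET.

Lemma mem_weight_sites i : (i \in weight_sites) =
  match i with inl f => f \in edges G | inr x => x \in vertices G end.
Proof.
have inlI : injective (@inl {set V} V) by move=> ? ? [].
have inrI : injective (@inr {set V} V) by move=> ? ? [].
case: i => [f|x]; rewrite inE ?(mem_imset _ _ inlI) ?(mem_imset _ _ inrI).
  by case: (f \in edges G) => //=; apply/imsetP => -[].
by rewrite orbC; case: (x \in vertices G) => //=; apply/imsetP => -[].
Qed.

Lemma card_reach i : i \in weight_sites -> (#|reach i| <= (max_degree G).+1)%N.
Proof.
rewrite mem_weight_sites; case: i => [f|x] /= iG.
  rewrite (edges_card iG) ltnS; have /card_gt0P[x xf] : (0 < #|f|)%N.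
    by rewrite (edges_card iG).
  apply: leq_trans (degree_le_max x); apply/card_gt0P; exists f.
  by rewrite inE iG.
rewrite cardsU1; have := card_neighbours x; case: (_ \notin _) => /=; lia.
Qed.

Lemma card_near x : (#|near x| <= (2 * max_degree G).+1)%N.
Proof.
apply: (@leq_trans #|(inl @: [set f in edges G | x \in f]) :|:
   (inr @: (x |: neighbours x))|%SET).
  apply: subset_leq_card; apply/fintype.subsetP => -[f|y].
    rewrite [_ \in near x]inE mem_weight_sites => /andP[fG xf].
    rewrite finset.in_setU; apply/orP; left.
    by apply/imsetP; exists f; rewrite ?inE ?fG.
  rewrite [_ \in near x]inE mem_weight_sites => /andP[_ xy].
  rewrite finset.in_setU; apply/orP; right.
  apply/imsetP; exists y => //; move: xy.
  by rewrite !inE adjC (eq_sym x).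
apply: (leq_trans (leq_card_setU _ _)).
rewrite mul2n -addnn -addnS; apply: leq_add.
  exact: leq_trans (leq_imset_card _ _) (degree_le_max x).
apply: leq_trans (leq_imset_card _ _) _; rewrite cardsU1.
have := card_neighbours x; case: (_ \notin _) => /=; lia.
Qed.

Definition near_path (s : seq V) : {set {set V} + V} := \bigcup_(z in [set z in s]%SET) near z.


Lemma mem_near_path s i :
  (i \in near_path s) = (i \in weight_sites) && has (fun z => z \in reach i) s.
Proof.
apply/bigcupP/andP => [[z]|[iG /hasP[z zs zi]]].
  rewrite !inE => zs /andP[iG zi]; split=> //; apply/hasP; exists z => //.
by exists z; rewrite inE // iG.
Qed.

Lemma card_near_path s : (#|near_path s| <= size s * (2 * max_degree G).+1)%N.
Proof.
apply: leq_trans (card_bigcup_leq _ _) _.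
apply: (@leq_trans (\sum_(z in [set z in s]%SET) (2 * max_degree G).+1)%N).
  by apply: leq_sum => z _; exact: card_near.
by rewrite sum_nat_const leq_mul2r cardsE card_size orbT.
Qed.

(** A site is responsible for at most [D.+1] vertices, the size of its reach;
    so [k] vertices that each need some site of [J] force [J] to have at least
    [k / D.+1] elements. *)
Lemma count_le_reach (good : pred V) (J : {set {set V} + V}) (s : seq V) :
    uniq s -> J \subset weight_sites ->
    (forall z, z \in s -> ~~ good z -> exists2 i, i \in J & z \in reach i) ->
  (size s <= count good s + #|J| * (max_degree G).+1)%N.
Proof.
move=> us JG badJ; rewrite -(count_predC good s) leq_add2l -size_filter.
rewrite -(card_uniqP (filter_uniq _ us)).
apply: (@leq_trans #|\bigcup_(i in J) reach i|%SET).
  apply: subset_leq_card; apply/fintype.subsetP => z.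
  rewrite mem_filter => /andP[bz /badJ /(_ bz)[i iJ zi]].
  by apply/bigcupP; exists i.
apply: leq_trans (card_bigcup_leq _ _) _; rewrite -sum_nat_const.
by apply: leq_sum => i /(fintype.subsetP JG) /card_reach.
Qed.

End Geometry.

(** * Heavy weights *)

Section Heavy.
Variables (R : realType) (V : finType) (G : graph V).
Variables (w : {set V} -> R) (nu : V -> R) (L : R).

Definition heavy (i : {set V} + V) : bool :=
  match i with inl f => L < w f | inr x => nu x < - L end.

(** With edge weights at most [L] and vertex weights at least [- L], each of the
    at most [D] terms of [a x] is at most [exp (3 * L)]. *)
Definition tame_bound : R := (max_degree G)%:R * expR (3 * L).

Lemma tame_of_light x : x \in vertices G ->
  (forall i, i \in weight_sites G -> x \in reach G i -> ~~ heavy i) ->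
  tame G w nu tame_bound x.
Proof.
move=> xG light; rewrite /tame /tame_bound.
apply: (@le_trans _ _ (\sum_(y | adj G x y) expR (3 * L))).
  apply: ler_sum => y xy; have /andP[_ yG] := adj_vertices xy.
  have := light (inl [set x; y]%SET); rewrite mem_weight_sites => /(_ xy).
  rewrite !inE eqxx /= -leNgt => /(_ isT) lew.
  have := light (inr x); rewrite mem_weight_sites => /(_ xG).
  rewrite /= !inE eqxx /= -leNgt => /(_ isT) lex.
  have := light (inr y); rewrite mem_weight_sites => /(_ yG).
  rewrite /= !inE adjC xy orbT -leNgt => /(_ isT) ley.
  by rewrite /edge_factor ler_expR; lra.
rewrite sumr_const -[leLHS]mulr_natl ler_wpM2r ?expR_ge0 // ler_nat.
by apply: leq_trans (card_neighbours G x); rewrite cardsE.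
Qed.

(** A vertex of the path that is not tame has a heavy site in whose reach it
    lies, and every site serves at most [D.+1] vertices; so [J] can be the set of
    all heavy sites near the path. *)
Lemma untame_path_heavy n m x p : x \in vertices G -> path (adj G) x p ->
    uniq (x :: p) -> size p = n -> (count (tame G w nu tame_bound) (x :: p) <= m)%N ->
  exists J : {set {set V} + V}, [/\ J \subset near_path G (x :: p),
    forall i, i \in J -> heavy i & (n.+1 <= m + #|J| * (max_degree G).+1)%N].
Proof.
move=> xG xp up sp few_tame.
have pG z : z \in x :: p -> z \in vertices G.
  elim: p x xG xp {up sp few_tame} => [|y p IHp] x xG /=; first by rewrite inE => _ /eqP ->.
  case/andP => /adj_vertices /andP[_ yG] yp; rewrite inE => /orP[/eqP -> //|].
  exact: IHp.
exists [set i in near_path G (x :: p) | heavy i]%SET; split.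
- by apply/fintype.subsetP => i; rewrite inE => /andP[].
- by move=> i; rewrite inE => /andP[].
apply: (@leq_trans (count (tame G w nu tame_bound) (x :: p) +
   #|[set i in near_path G (x :: p) | heavy i]%SET| * (max_degree G).+1)); last first.
  by rewrite leq_add2r.
rewrite -sp -[(size p).+1]/(size (x :: p)); apply: count_le_reach => //.
  by apply/fintype.subsetP => i; rewrite inE mem_near_path => /andP[/andP[]].
move=> z zp /negP untame_z; apply: contrapT => no_heavy; apply: untame_z.
apply: tame_of_light => [|i iG zi]; first exact: pG.
apply/negP => hi; apply: no_heavy; exists i => //.
by rewrite inE hi mem_near_path iG andbT; apply/hasP; exists z.
Qed.

End Heavy.

(** * Balls around an edge *)

Section Ball.
Variables (R : realType) (V : finType) (G : graph V).

Lemma mem_edge_ball (e : {set V}) (r : R) (z : V) p :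
    z \in e -> z \in vertices G -> path (adj G) z p -> (size p)%:R <= r ->
  last z p \in [set v in vertices G | [exists x in e, (gdist G R x v <= r%:E)%E]]%SET.
Proof.
move=> ze zG zp sp; rewrite inE; apply/andP; split.
  elim: p z {ze sp} zG zp => [|y p IHp] z zG //= /andP[/adj_vertices /andP[_ yG]].
  exact: IHp.
apply/exists_inP; exists z => //; apply: (@le_trans _ _ ((size p)%:R%:E)); last by rewrite lee_fin.
by apply: ereal_inf_lbound; exists p.
Qed.

End Ball.

(** * Union bound and tails *)

Section Probability.
Variables (R : realType) (d : measure_display) (T : measurableType d).
Variable (P : probability T R).

Lemma measure_bigsetU_le (I : eqType) (r : seq I) (F : I -> set T) (N : nat) (a : R) :
    0 <= a -> (size r <= N)%N ->
    (forall i, i \in r -> measurable (F i)) ->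
    (forall i, i \in r -> (P (F i) <= a%:E)%E) ->
  (P (\big[setU/set0]_(i <- r) F i) <= (N%:R * a)%:E)%E.
Proof.
move=> a0 sr mF Fa.
apply: (@le_trans _ _ ((size r)%:R * a)%:E); last by rewrite lee_fin ler_wpM2r ?ler_nat.
have : measurable (\big[setU/set0]_(i <- r) F i) /\
  (P (\big[setU/set0]_(i <- r) F i) <= ((size r)%:R * a)%:E)%E; last by case.
elim: r mF Fa {sr} => [|i r IHr] mF Fa.
  by rewrite big_nil measure0 mul0r.
have [|j jr|mr Pr] := IHr; first by move=> j jr; apply: mF; rewrite inE jr orbT.
  by apply: Fa; rewrite inE jr orbT.
have mi : measurable (F i) by apply: mF; rewrite inE eqxx.
rewrite big_cons; split; first exact: measurableU.
apply: (le_trans (measureU2 _ mi mr)).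
rewrite /= -addn1 natrD mulrDl mul1r addrC EFinD; apply: leeD => //.
by apply: Fa; rewrite inE eqxx.
Qed.

(** The integral of a nonnegative function is a supremum over the simple
    functions below it, so the pointwise bound [f <= c + \1_B] is enough. *)
Lemma expectation_le_exceptional (f : T -> R) (c : R) (B : set T) :
    0 <= c -> measurable B -> (forall t, 0 <= f t <= 1) ->
    (forall t, ~ B t -> f t <= c) ->
  ('E_P[f] <= c%:E + P B)%E.
Proof.
move=> c0 mB f01 fc; rewrite unlock.
apply: (@le_trans _ _ (\int[P]_t ((cst c%:E t) + (\1_B t)%:E)))%E; last first.
  rewrite ge0_integralD //.
  - rewrite integral_cst // [X in (_ * X)%E](probability_setT P) mule1.
    by rewrite integral_indic // setIT.
  - by apply/measurable_EFinP; exact: measurable_indic.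
rewrite !ge0_integralTE; first last.
- by move=> t; rewrite lee_fin; case/andP: (f01 t).
- by move=> t; rewrite /= -EFinD lee_fin addr_ge0.
apply: ereal_sup_le => _ [g gf <-]; exists g => // t.
apply: le_trans (gf t) _; rewrite /= -EFinD lee_fin indicE.
case: (boolP (t \in B)) => tB.
  by rewrite (le_trans (andP (f01 t)).2) // lerDr.
by rewrite addr0 fc //; apply: contraNnot tB => /mem_set.
Qed.

End Probability.

Section Tails.
Variables (R : realType).

(** A law on the line is the law of the identity, which gives access to the
    limits of distribution functions at infinity. *)
Let id_real : R -> R := idfun.

#[local] HB.instance Definition _ :=
  @isMeasurableFun.Build _ _ R R id_real (@measurable_id _ R setT).

Lemma upper_tail (mu : probability R R) (eps : R) : 0 < eps ->
  \forall L \near +oo, (mu `]L, +oo[%classic <= eps%:E)%E.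
Proof.
move=> eps0.
pose X : {RV mu >-> R} := id_real.
have := @cvg_ccdfy0 _ _ _ _ X [set y | (y < eps%:E)%E]%classic.
case; first by apply: open_nbhs_nbhs; split; [exact: open_ereal_lt_ereal | rewrite /= lte_fin].
move=> M [_ XM]; exists M; split => [|L /XM /ltW]; [exact: num_real | exact].
Qed.

Lemma lower_tail (mu : probability R R) (eps : R) : 0 < eps ->
  \forall L \near +oo, (mu `]-oo, (- L)%R[%classic <= eps%:E)%E.
Proof.
move=> eps0.
pose X : {RV mu >-> R} := id_real.
have := @cvg_cdfNy0 _ _ _ _ X [set y | (y < eps%:E)%E]%classic.
case; first by apply: open_nbhs_nbhs; split; [exact: open_ereal_lt_ereal | rewrite /= lte_fin].
move=> M [_ XM]; exists (- M); split => // [|L ML]; first exact: num_real.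
have /XM /ltW : - L < M by rewrite ltrNl.
apply: le_trans; apply: le_measure; rewrite ?inE.
- exact: measurable_itv.
- exact: measurable_itv.
- by move=> t; rewrite /= !in_itv /=; exact: ltW.
Qed.

End Tails.

(** * The exceptional event *)

Section ExceptionalEvent.
Variables (R : realType) (V : finType) (G : graph V).
Variables (d : measure_display) (T : measurableType d) (P : probability T R).
Variables (mu_e mu_v : probability R R).
Variables (w : {set V} -> {RV P >-> R}) (nu : V -> {RV P >-> R}).
Variable L : R.
Implicit Types (i : {set V} + V) (J : {set {set V} + V}).

Definition heavy_values i : set R :=
  match i with inl _ => `]L, +oo[%classic | inr _ => `]-oo, (- L)%R[%classic end.

Definition all_heavy J : set T :=
  (\bigcap_(i in [set` J]) (weight_family w nu i @^-1` heavy_values i))%classic.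

(** The event that the neighbourhood of some long walk from [e] is rich in heavy
    sites, spelled out as a union over walks and sets of sites so that the union
    bound and measurability are immediate. *)
Definition exceptional (e : {set V}) (n s : nat) : set T :=
  \big[setU/set0]_(z <- enum e) \big[setU/set0]_(p <- walks G n z)
    \big[setU/set0]_(J <- enum [set J in powerset (near_path G (z :: p)) | (s <= #|J|)%N]%SET)
      all_heavy J.

Lemma measurable_heavy_values i : measurable (heavy_values i).
Proof. by case: i => ?; exact: measurable_itv. Qed.

Lemma measurable_all_heavy J : measurable (all_heavy J).
Proof.
apply: fin_bigcap_measurable => [|i _]; first exact: finite_finset.
by apply: measurable_funPTI; exact: measurable_heavy_values.
Qed.

Lemma all_heavyP J t :
  all_heavy J t <-> (forall i, i \in J -> heavy (w^~ t) (nu^~ t) L i).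
Proof.
split=> HJ i iJ; have := HJ i iJ; case: i {iJ} => ?;
  by rewrite /= in_itv /= ?andbT.
Qed.

Lemma measurable_exceptional e n s : measurable (exceptional e n s).
Proof.
do 3!(apply: bigsetU_measurable => ? _); exact: measurable_all_heavy.
Qed.

Lemma all_heavy_prob eps J :
    disordered_weights G mu_e mu_v w nu -> 0 <= eps <= 1 ->
    (mu_e `]L, +oo[%classic <= eps%:E)%E ->
    (mu_v `]-oo, (- L)%R[%classic <= eps%:E)%E ->
    J \subset weight_sites G ->
  (P (all_heavy J) <= (eps ^+ #|J|)%:E)%E.
Proof.
move=> [we wv indep] eps01 edge_tail vertex_tail JG.
rewrite /all_heavy (indep J heavy_values JG); last first.
  by move=> i _; exact: measurable_heavy_values.
have tail i : i \in J -> (P (weight_family w nu i @^-1` heavy_values i)%classic <= eps%:E)%E.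
  move=> /(fintype.subsetP JG); rewrite mem_weight_sites.
  case: i => [f fG|x xG] /=.
    by have := we f _ fG (measurable_heavy_values (inl f)); rewrite /distribution /pushforward => ->.
  by have := wv x _ xG (measurable_heavy_values (inr x)); rewrite /distribution /pushforward => ->.
have finP i : P (weight_family w nu i @^-1` heavy_values i)%classic =
    (fine (P (weight_family w nu i @^-1` heavy_values i)%classic))%:E.
  rewrite fineK // fin_num_measure //.
  by apply: measurable_funPTI; exact: measurable_heavy_values.
under eq_bigr do rewrite finP.
rewrite prodEFin lee_fin -prodr_const; apply: ler_prod => i iJ.
by rewrite fine_ge0 //= -lee_fin -finP tail.
Qed.

(** There are two endpoints, at most [D ^ n] walks from each, and
    [2 ^ (n.+1 * (2 * D).+1)] sets of sites near a walk, since each of its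
    [n.+1] vertices is in the reach of at most [(2 * D).+1] sites. *)
Lemma exceptional_prob eps e n s :
    disordered_weights G mu_e mu_v w nu -> 0 <= eps <= 1 ->
    (mu_e `]L, +oo[%classic <= eps%:E)%E ->
    (mu_v `]-oo, (- L)%R[%classic <= eps%:E)%E ->
    e \in edges G ->
  (P (exceptional e n s) <= (2 * ((max_degree G)%:R ^+ n *
     (2 ^+ (n.+1 * (2 * max_degree G).+1) * eps ^+ s)))%:E)%E.
Proof.
move=> weights_iid eps01 edge_tail vertex_tail eG; have /andP[eps0 eps1] := eps01.
have c0 : 0 <= 2 ^+ (n.+1 * (2 * max_degree G).+1) * eps ^+ s :> R.
  by rewrite mulr_ge0 ?exprn_ge0.
rewrite -natrX; apply: measure_bigsetU_le.
- by rewrite mulr_ge0.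
- by rewrite -cardE (edges_card eG).
- by move=> z _; do 2!(apply: bigsetU_measurable => ? _); exact: measurable_all_heavy.
move=> z _; apply: measure_bigsetU_le => //.
- exact: size_walks.
- by move=> p _; apply: bigsetU_measurable => ? _; exact: measurable_all_heavy.
move=> p pn; have sp : size p = n.
  elim: n z p pn {c0} => [|n IHn] z p /=; first by rewrite inE => /eqP ->.
  by move=> /flattenP[_ /mapP[y _ ->] /mapP[q /IHn <- ->]].
rewrite -natrX; apply: measure_bigsetU_le.
- by rewrite exprn_ge0.
- rewrite -cardE; apply: leq_trans (_ : #|powerset (near_path G (z :: p))| <= _)%N.
    by apply: subset_leq_card; apply/fintype.subsetP => J; rewrite inE => /andP[].
  rewrite card_powerset leq_exp2l // -sp; exact: card_near_path.
- by move=> J _; exact: measurable_all_heavy.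
move=> J; rewrite mem_enum inE powersetE => /andP[JN sJ].
apply: le_trans (all_heavy_prob weights_iid eps01 edge_tail vertex_tail _) _.
  apply: (fintype.subset_trans JN); apply/fintype.subsetP => i.
  by rewrite mem_near_path => /andP[].
by rewrite lee_fin ler_wiXn2l.
Qed.

(** Of the [2 * D.+1 * s + 1] vertices of such a path, if at most half of
    [2 * D.+1 * s] were tame, more than [D.+1 * s] others would need heavy sites,
    each serving at most [D.+1] of them; hence at least [s] heavy sites. *)
Lemma not_exceptional_tame (e : {set V}) (D s : nat) t z p :
    D = max_degree G ->
    ~ exceptional e (2 * (D.+1 * s)) s t -> z \in e -> z \in vertices G ->
    path (adj G) z p -> uniq (z :: p) -> size p = (2 * (D.+1 * s))%N ->
  (D.+1 * s < count (tame G (w^~ t) (nu^~ t) (tame_bound G L)) (z :: p))%N.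
Proof.
move=> eqD nexc ze zG zp up sp; rewrite ltnNge; apply/negP => few_tame; apply: nexc.
have [J [JN heavyJ]] := untame_path_heavy zG zp up sp few_tame.
rewrite -eqD => cardJ.
rewrite /exceptional -bigcup_seq; exists z; first by rewrite /= mem_enum.
rewrite -bigcup_seq; exists p; first by rewrite /= -sp mem_walks.
rewrite -bigcup_seq; exists J; last exact/all_heavyP.
rewrite /= mem_enum inE powersetE JN /= -(leq_pmul2l (ltn0Sn D)).
by rewrite [(D.+1 * #|J|)%N]mulnC; lia.
Qed.

End ExceptionalEvent.

(** * Choice of the constants and conclusion *)

Lemma gibbs_edge_prob01 (R : realType) (V : finType) (G : graph V)
    (w : {set V} -> R) (nu : V -> R) (e : {set V}) :
  0 <= gibbs_expectation G w nu (fun M => (e \in M)%:R) <= 1.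
Proof.
have Z0 := partition_function_gt0 w nu G.
have g0 M : 0 <= gibbs G w nu M by rewrite divr_ge0 ?expR_ge0 ?(ltW Z0).
apply/andP; split; first by apply: sumr_ge0 => M _; rewrite mulr_ge0.
have sum1 : \sum_(M | matching G M) gibbs G w nu M = 1.
  by rewrite /gibbs -mulr_suml divff // lt0r_neq0.
by rewrite -[leRHS]sum1; apply: ler_sum => M _; apply: ler_piMl => //; rewrite lern1 leq_b1.
Qed.

(** Rounding [r / k] down costs the factor [rho^-1]. *)
Lemma geometric_exponential (R : realType) (rho : R) (k : nat) (r : R) :
    0 < rho < 1 -> (0 < k)%N ->
  rho ^+ Num.truncn (r / k%:R) <= rho^-1 * expR (- (- ln rho / k%:R) * r).
Proof.
move=> /andP[rho0 rho1] k0; have k0' : 0 < k%:R :> R by rewrite ltr0n.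
rewrite -(ler_pM2l rho0) mulrA divff ?lt0r_neq0 // mul1r -exprS.
rewrite -{1}(lnK (x := rho)) ?posrE // -expRM_natl ler_expR.
have lnr : ln rho < 0 by rewrite ln_lt0 // rho0.
have rk : r / k%:R < (Num.truncn (r / k%:R)).+1%:R by exact: truncnS_gt.
have -> : - (- ln rho / k%:R) * r = r / k%:R * ln rho by field; exact: lt0r_neq0.
by rewrite ler_wnM2r // ltW.
Qed.

Section EntropyVersusRarity.
Variables (R : realType) (D : nat).

(** Bound on the growth, per unit of [s], of the number of pairs made of a walk of length
    [2 * D.+1 * s] and a set of sites near it.  The base [D.+1] instead of
    [D] keeps it at least [1] when [D = 0]. *)
Definition path_entropy : R :=
  D.+1%:R ^+ (2 * D.+1) * 2 ^+ (2 * D.+1 * (2 * D).+1).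

(** The tail probability to be reached by choosing [L]: it beats the entropy by
    a factor [2]. *)
Definition rarity : R := (2 * path_entropy)^-1.

Lemma path_entropy_ge1 : 1 <= path_entropy.
Proof. by rewrite mulr_ege1 // exprn_ege1 // ler1n. Qed.

Lemma rarity_itv : 0 < rarity <= 1.
Proof.
have A1 := path_entropy_ge1.
rewrite invr_gt0 invf_le1; last by lra.
apply/andP; split; lra.
Qed.

Lemma exceptional_bound s (n := (2 * (D.+1 * s))%N) :
  D%:R ^+ n * (2 ^+ (n.+1 * (2 * D).+1) * rarity ^+ s)
    <= 2 ^+ (2 * D).+1 * (2^-1) ^+ s :> R.
Proof.
have A1 := path_entropy_ge1; have /andP[e0 _] := rarity_itv.
apply: (@le_trans _ _ (D.+1%:R ^+ n * (2 ^+ (n.+1 * (2 * D).+1) * rarity ^+ s))).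
  rewrite ler_wpM2r ?mulr_ge0 ?exprn_ge0 ?(ltW e0) //.
  by rewrite lerXn2r ?nnegrE ?ler_nat.
have -> : 2^-1 = path_entropy * rarity by rewrite /rarity; field; lra.
have -> : (n.+1 * (2 * D).+1 = (2 * D).+1 + 2 * D.+1 * (2 * D).+1 * s)%N.
  by rewrite /n mulSn mulnA mulnAC.
rewrite exprD /n mulnA [D.+1%:R ^+ _]exprM [2 ^+ (_ * s)]exprM [(path_entropy * _) ^+ s]exprMn.
rewrite /path_entropy [(_ * 2 ^+ _) ^+ s]exprMn.
by rewrite le_eqVlt; apply/orP; left; apply/eqP; ring.
Qed.

End EntropyVersusRarity.

Theorem theorem1p7 (R : realType) (D : nat)
    (mu_e mu_v : probability R R) :
  exists c C : R, 0 < c /\ 0 < C /\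
    forall (V : finType) (G : graph V) (d : measure_display)
      (T : measurableType d) (P : probability T R)
      (w : {set V} -> {RV P >-> R}) (nu : V -> {RV P >-> R}),
      max_degree G = D ->
      disordered_weights G mu_e mu_v w nu ->
      forall (e : {set V}) (r : R), e \in edges G -> 1 <= r ->
        ('E_P[fun omega =>
             `| gibbs_expectation G (w^~ omega) (nu^~ omega)
                  (fun M => (e \in M)%:R)
              - gibbs_expectation (edge_ball G e r) (w^~ omega) (nu^~ omega)
                  (fun M => (e \in M)%:R) |%R]
         <= (C * expR (- c * r))%:E)%E.
Proof.
have /andP[eps0 eps1] := rarity_itv R D.
have [L [edge_tail vertex_tail]] : exists L : R,
    (mu_e `]L, +oo[%classic <= (rarity R D)%:E)%E /\
    (mu_v `]-oo, (- L)%R[%classic <= (rarity R D)%:E)%E.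
  apply: (@filter_ex _ (nbhs +oo%R)).
  by apply: filterI; [exact: upper_tail | exact: lower_tail].
pose K : R := D%:R * expR (3 * L).
have K0 : 0 <= K by rewrite mulr_ge0 ?expR_ge0.
pose q := K / (1 + K).
have q0 : 0 <= q by rewrite divr_ge0 // addr_ge0.
have q1 : q < 1 by rewrite ltr_pdivrMr; lra.
(* [q] is the rate of the deterministic decay, [1/2] that of the probability of
   the exceptional event. *)
pose rho := Num.max q 2^-1.
have qrho : q <= rho by rewrite le_max lexx.
have hrho : 2^-1 <= rho by rewrite le_max lexx orbT.
have rho01 : 0 < rho < 1 by rewrite lt_max gt_max q1; apply/andP; split; lra.
have /andP[rho0 rho1] := rho01.
have lnrho : ln rho < 0 by rewrite ln_lt0.
pose k := (2 * D.+1)%N.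
have k0 : 0 < k%:R :> R by rewrite ltr0n.
pose C0 : R := 2 * (1 + K) + 2 * 2 ^+ (2 * D).+1.
have C00 : 0 < C0 by rewrite addr_gt0 ?mulr_gt0 ?exprn_gt0 //; lra.
exists (- ln rho / k%:R), (C0 * rho^-1).
split; first by rewrite divr_gt0 // oppr_gt0.
split; first by rewrite mulr_gt0 ?invr_gt0.
move=> V G d T P w nu maxD weights_iid e r eG r1.
have r0 : 0 <= r by lra.
(* [n] is a multiple of [2 * D.+1] not exceeding [r], so that walks of length [n]
   stay in the ball. *)
pose s := Num.truncn (r / k%:R); pose n := (2 * (D.+1 * s))%N.
have nr : n%:R <= r.
  have : s%:R <= r / k%:R by rewrite truncn_le divr_ge0 ?(ltW k0).
  have -> : n = (s * k)%N by rewrite /n mulnA mulnC.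
  by rewrite ler_pdivlMr // -natrM.
pose B := exceptional G w nu L e n s.
have mB : measurable B by exact: measurable_exceptional.
pose err := 2 * (1 + K) * q ^+ (D.+1 * s).
have err0 : 0 <= err by rewrite !mulr_ge0 ?exprn_ge0 ?addr_ge0.
apply: (@le_trans _ _ (err%:E + P B)%E).
  apply: expectation_le_exceptional => // t.
    have /andP[a0 a1] := gibbs_edge_prob01 G (w^~ t) (nu^~ t) e.
    have /andP[b0 b1] := gibbs_edge_prob01 (edge_ball G e r) (w^~ t) (nu^~ t) e.
    rewrite normr_ge0 ler_norml /=; apply/andP; split; lra.
  move=> tB; have /cards2P[x [y [neq_xy eq_e]]] : #|e| == 2%N by rewrite (edges_card eG).
  have xy : adj G x y by rewrite /adj -eq_e.
  have eV z : z \in e -> z \in vertices G.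
    by move=> ze; exact: (fintype.subsetP (edges_sub eG)).
  have xe : x \in e by rewrite eq_e !inE eqxx.
  have ye : y \in e by rewrite eq_e !inE eqxx orbT.
  have ball z p : z \in e -> path (adj G) z p -> (size p <= n)%N ->
      last z p \in [set v in vertices G | [exists x in e, (gdist G R x v <= r%:E)%E]]%SET.
    move=> ze zp sp; apply: mem_edge_ball => //; first exact: eV.
    by apply: le_trans nr; rewrite ler_nat.
  rewrite -[X in gibbs_expectation X _ _ _ - _]induced_subgraphT {1 3}eq_e.
  apply: (edge_prob_decay (n := n)) => //; rewrite ?finset.in_setT //.
  - exact: (ball x [::]).
  - exact: (ball y [::]).
  - by rewrite -eq_e => z p ze zp sp; rewrite finset.in_setT ball.
  - rewrite -eq_e => z p ze zp up sp.
    have := not_exceptional_tame (esym maxD) tB ze (eV _ ze) zp up sp.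
    by rewrite /tame_bound maxD.
have eps01 : 0 <= rarity R D <= 1 by rewrite (ltW eps0).
have PB := exceptional_prob n s weights_iid eps01 edge_tail vertex_tail eG.
apply: (le_trans (leeD (lexx _) PB)); rewrite -EFinD lee_fin maxD.
have bad := exceptional_bound R D s.
have good : q ^+ (D.+1 * s) <= rho ^+ s.
  apply: (@le_trans _ _ (q ^+ s)); last by rewrite lerXn2r ?nnegrE ?(ltW rho0).
  by apply: ler_wiXn2l; rewrite ?(ltW q1) // mulSn leq_addr.
have half : 2^-1 ^+ s <= rho ^+ s :> R by rewrite lerXn2r ?nnegrE ?(ltW rho0).
apply: (@le_trans _ _ (C0 * rho ^+ s)); last first.
  rewrite -mulrA ler_pM2l //; exact: geometric_exponential.
rewrite /C0 [leRHS]mulrDl; apply: lerD.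
  by rewrite ler_wpM2l // mulr_ge0 // addr_ge0.
rewrite -mulrA ler_pM2l //; apply: (le_trans bad).
by rewrite ler_pM2l // exprn_gt0.
Qed.
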